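(* Let $H$ be a finite simple graph with $e(H)$ edges, and let $\beta_2<0$ satisfy $|\beta_2|\,e(H)(e(H)-1)<2$. Then for every $\epsilon\in[0,1]$ the optimizing graphon of the variational problem $$\psi(\epsilon,\beta_2)=\sup\left\{\beta_2 t(H,h)-\frac12\iint_{[0,1]^2}I(h(x,y))\,dx\,dy\;:\;h\text{ a graphon},\ \iint_{[0,1]^2}h(x,y)\,dx\,dy=\epsilon\right\}$$ is uniform.
   Context: A graphon is a measurable function $h:[0,1]^2\to[0,1]$ with $h(x,y)=h(y,x)$. $I(x)=x\log x+(1-x)\log(1-x)$ on $[0,1]$, with $0\log 0=0$. For a finite simple graph $H$ with vertex set $\{1,\dots,v(H)\}$ and edge set $E(H)$, put $t(H,h)=\int_{[0,1]^{v(H)}}\prod_{\{i,j\}\in E(H)}h(x_i,x_j)\,dx_1\cdots dx_{v(H)}$. An optimizing graphon is a graphon with $\iint h=\epsilon$ attaining the supremum in the definition of $\psi(\epsilon,\beta_2)$. ''The optimizing graphon is uniform'' means that every optimizing graphon is a.e. constant (hence a.e. equal to $\epsilon$). *)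

(* Defs.v *)
From HB Require Import structures.
From mathcomp Require Import all_boot all_order all_algebra.
From mathcomp Require Import all_classical all_reals all_analysis.
Set Implicit Arguments.
Unset Strict Implicit.
Unset Printing Implicit Defensive.
Import Order.TTheory GRing.Theory Num.Theory.
Import numFieldNormedType.Exports.
Local Open Scope classical_set_scope.
Local Open Scope ring_scope.

Section tuple_measure.
Context d (T : measurableType d) (R : realType).
Variable mu : {sigma_finite_measure set T -> \bar R}.

Definition tuple_cons n (p : T * n.-tuple T) : n.+1.-tuple T :=
  [tuple of p.1 :: p.2].

Lemma measurable_tuple_cons n :
  measurable_fun [set: T * n.-tuple T] (@tuple_cons n).
Proof. exact: measurable_cons. Qed.

Section tuple_cons_measure.
Variables (n : nat) (m : {sigma_finite_measure set (n.-tuple T) -> \bar R}).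

Definition tuple_cons_measure : set (n.+1.-tuple T) -> \bar R :=
  pushforward (mu \x m)%E (@tuple_cons n).

Let nu : {measure set (n.+1.-tuple T) -> \bar R} :=
  @measure_function_pushforward__canonical__measure_function_Measure
    _ _ _ _ _ (mu \x m)%E _ (@measurable_tuple_cons n).

HB.instance Definition _ := isMeasure.Build _ _ _ tuple_cons_measure
  (measure0 nu) (measure_ge0 nu) (@measure_semi_sigma_additive _ _ _ nu).

Let tuple_cons_measure_sigma_finite : sigma_finite setT tuple_cons_measure.
Proof.
have /sigma_finiteP[F [TF ndF Foo]] := sigma_finiteT mu.
have /sigma_finiteP[G [TG ndG Goo]] := sigma_finiteT m.
pose u (t : n.+1.-tuple T) : T * n.-tuple T := (thead t, [tuple of behead t]).
have mu_ : measurable_fun [set: n.+1.-tuple T] u.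
  apply/measurable_fun_pair; first exact: measurable_tnth.
  exact: measurable_behead.
have uK : cancel (@tuple_cons n) u.
  by case=> x t; congr pair => //; apply: val_inj.
exists (fun k => u @^-1` (F k `*` G k)).
  rewrite -preimage_bigcup predeqE => t; split => // _.
  have [i _ Fi] : (\bigcup_i F i) (u t).1 by rewrite -TF.
  have [j _ Gj] : (\bigcup_j G j) (u t).2 by rewrite -TG.
  exists (maxn i j) => //; split.
  - by move: (u t).1 Fi; exact/subsetPset/ndF/leq_maxl.
  - by move: (u t).2 Gj; exact/subsetPset/ndG/leq_maxr.
move=> k; have [mF Fk] := Foo k; have [mG Gk] := Goo k; split.
  by rewrite -[X in measurable X]setTI; apply: mu_ => //; exact: measurableX.
rewrite /tuple_cons_measure /pushforward -comp_preimage (_ : u \o _ = id); last first.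
  by apply/funext => p; exact: uK.
by rewrite preimage_id product_measure1E// lte_mul_pinfty// ge0_fin_numE.
Qed.

HB.instance Definition _ := Measure_isSigmaFinite.Build _ _ _
  tuple_cons_measure tuple_cons_measure_sigma_finite.

End tuple_cons_measure.

(* n-fold product measure, transported along T * T^n ~ T^(n+1);
   tuple_measure_box gives its values on boxes. *)
Fixpoint tuple_measure n : {sigma_finite_measure set (n.-tuple T) -> \bar R} :=
  match n with
  | 0 => \d_([tuple] : 0.-tuple T)
  | n'.+1 => tuple_cons_measure (tuple_measure n')
  end.

Lemma tuple_measure_box n (A : 'I_n -> set T) :
  (forall i, measurable (A i)) ->
  tuple_measure n [set t : n.-tuple T | forall i, A i (tnth t i)] =
  (\prod_(i < n) mu (A i))%E.
Proof.
elim: n A => [|n IH] A mA /=.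
  by rewrite big_ord0 diracE mem_set // => -[].
rewrite big_ord_recl -IH; last by move=> i; exact: mA.
set B := [set t : n.-tuple T | _].
have mB : measurable B.
  rewrite (_ : B = \bigcap_(i in [set: 'I_n])
      ((fun t : n.-tuple T => tnth t i) @^-1` A (lift ord0 i))).
    apply: fin_bigcap_measurable => // i _; rewrite -[X in measurable X]setTI.
    exact: measurable_tnth.
  by apply/seteqP; split=> t h i => [_|]; [exact: h|exact: (h i I)].
rewrite /tuple_cons_measure /pushforward -product_measure1E //; congr (_ _ _).
apply/seteqP; split=> [[x t] /= h|[x t] /= [hx ht] i].
  split=> [|i]; first by have := h ord0; rewrite tnth0.
  by have := h (lift ord0 i); rewrite tnthS.
by case: (unliftP ord0 i) => [j ->|->]; rewrite ?tnthS ?tnth0 //; exact: ht.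
Qed.
End tuple_measure.
Arguments tuple_measure {d T R} mu n.

Section graphon.
Context {R : realType}.
Local Notation T := (measurableTypeR R).
Local Notation leb := (@lebesgue_measure R).
Local Notation leb2 := (leb \x leb)%E.

Definition unit_square : set (T * T) := `[0, 1]%classic `*` `[0, 1]%classic.

Definition unit_cube n : set (n.-tuple T) :=
  [set x | forall i, 0 <= tnth x i <= 1].

(* Values off the unit square are irrelevant. Measurability is Borel. *)
Definition graphon (h : T * T -> R) : Prop :=
  [/\ measurable_fun unit_square h,
      forall z, unit_square z -> 0 <= h z <= 1 &
      forall x y, unit_square (x, y) -> h (x, y) = h (y, x)].

(* ln 0 = 0 *)
Definition entropy (x : R) : R := x * ln x + (1 - x) * ln (1 - x).

(* Each edge {i, j} of the simple graph is represented once, by the pair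
   with i < j. *)
Definition edges n (e : rel 'I_n) : {set 'I_n * 'I_n} :=
  [set p : 'I_n * 'I_n | (p.1 < p.2)%N && e p.1 p.2]%SET.

Definition hom_density n (e : rel 'I_n) (h : T * T -> R) : R :=
  \int[tuple_measure leb n]_(x in @unit_cube n)
    \prod_(p in edges e) h (tnth x p.1, tnth x p.2).

Definition edge_density (h : T * T -> R) : R :=
  \int[leb2]_(z in unit_square) h z.

Definition functional n (e : rel 'I_n) (beta2 : R) (h : T * T -> R) : R :=
  beta2 * hom_density e h
  - 2^-1 * \int[leb2]_(z in unit_square) entropy (h z).

Definition psi n (e : rel 'I_n) (eps beta2 : R) : \bar R :=
  ereal_sup [set (functional e beta2 h)%:E | h in
    [set h | graphon h /\ edge_density h = eps]].

Definition optimizing_graphon n (e : rel 'I_n) (eps beta2 : R)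
    (h : T * T -> R) : Prop :=
  [/\ graphon h, edge_density h = eps &
      (functional e beta2 h)%:E = psi e eps beta2].

Definition uniform (h : T * T -> R) : Prop :=
  exists c : R, {ae leb2, forall z, unit_square z -> h z = c}.

End graphon.

(* Main.v *)
Require Import Defs.
From mathcomp Require Import all_boot all_order all_algebra.
From mathcomp Require Import all_classical all_reals all_analysis.
From mathcomp Require Import measurable_realfun ring lra.
Import Order.TTheory GRing.Theory Num.Theory.
Import numFieldNormedType.Exports.
Local Open Scope classical_set_scope.
Local Open Scope ring_scope.
Set Implicit Arguments.
Unset Strict Implicit.

(* The constant graphon is compared directly with a competitor h of the same
   edge density eps. Write V for the integral of (h - eps)^2 and m for the
   number of edges. The first-order parts of both terms of the functional at
   the constant eps are multiples of the integral of h - eps, hence vanish. By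
   AM-GM on pairs of edges, t(H, h) >= eps^m - m (m - 1) / 2 * V; by the binary
   Pinsker inequality, the integral of I(h) is at least I(eps) + 2 V. So
   passing from eps to h changes the functional by at most
   (|beta2| m (m - 1) / 2 - 1) V, which is negative unless V = 0. Pinsker needs
   0 < eps < 1; for eps = 0 or 1 the constraint alone forces h = eps a.e. *)

(** * Second-order lower bound for a product of numbers in [0,1] *)

(** Telescoping: the factors are replaced by [c] one at a time, and each replacement costs at most
    |a_i - c| because the remaining factors lie in [0,1]. *)
Lemma dist_prod_expr (R : realFieldType) (I : Type) (s : seq I) (a : I -> R)
    (c : R) : 0 <= c <= 1 -> (forall i, 0 <= a i <= 1) ->
  `|\prod_(i <- s) a i - c ^+ size s| <= \sum_(i <- s) `|a i - c|.
Proof.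
move=> /andP[c0 c1] a01; elim: s => [|i s IH].
  by rewrite !big_nil subrr normr0.
rewrite !big_cons /= exprS; have /andP[ai0 ai1] := a01 i.
set P := \prod_(j <- s) a j in IH *.
rewrite (_ : _ - _ = c * (P - c ^+ size s) + (a i - c) * P); last by ring.
rewrite (le_trans (ler_normD _ _))// addrC lerD//.
  rewrite normrM ler_piMr// ger0_norm ?prodr_ge0// => [|j _]; last first.
    by case/andP: (a01 j).
  by apply: prodr_ile1 => j _; exact: a01.
by rewrite (le_trans _ IH)// normrM ger0_norm// ler_piMl.
Qed.

(** Induction via a_i P = c P + (a_i - c) c^k + (a_i - c)(P - c^k), with k the length of [s]. The
    last term is at least -|a_i - c| A by [dist_prod_expr]. AM-GM turns this into a loss of k/2 (a_i
    - c)^2 + Q/2, which raises the coefficient of the squares from (k - 1)/2 to exactly k/2. *)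
Lemma prod_ge_tangent (R : realFieldType) (I : Type) (s : seq I) (a : I -> R)
    (c : R) : 0 <= c <= 1 -> (forall i, 0 <= a i <= 1) ->
  c ^+ size s + c ^+ (size s).-1 * \sum_(i <- s) (a i - c)
    - ((size s)%:R - 1) / 2 * \sum_(i <- s) (a i - c) ^+ 2
  <= \prod_(i <- s) a i.
Proof.
move=> c01 a01; elim: s => [|i s IH].
  by rewrite !big_nil /= expr0 !mulr0 addr0 subr0.
have /andP[c0 c1] := c01; have /andP[ai0 ai1] := a01 i.
have := @dist_prod_expr R I s a c c01 a01.
rewrite !big_cons /=.
set P := \prod_(j <- s) a j in IH *.
set S := \sum_(j <- s) (a j - c) in IH *.
set Q := \sum_(j <- s) (a j - c) ^+ 2 in IH *.
set A := \sum_(j <- s) `|a j - c|.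
move=> PcA.
have Q0 : 0 <= Q by apply: sumr_ge0 => j _; exact: sqr_ge0.
(* AM-GM on each product |a i - c| |a j - c| *)
have cross : `|a i - c| * A <= (size s)%:R / 2 * (a i - c) ^+ 2 + Q / 2.
  rewrite /A /Q mulr_sumr mulr_suml.
  rewrite (_ : _ / 2 * _ = \sum_(j <- s) (a i - c) ^+ 2 / 2); last first.
    by rewrite big_const_seq count_predT iter_addr_0 -mulr_natl; field.
  rewrite -big_split /=; apply: ler_sum => j _.
  rewrite -(real_normK (num_real (a i - c))) -(real_normK (num_real (a j - c))).
  by have := sqr_ge0 (`|a i - c| - `|a j - c|); nra.
have eP : - (`|a i - c| * A) <= (a i - c) * (P - c ^+ size s).
  by rewrite lerNl (le_trans (ler_norm _))// normrN normrM ler_wpM2l.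
(* For empty [s] the truncated predecessor breaks c c^(k-1) = c^k, but then S = 0. *)
have ccS : c * (c ^+ (size s).-1 * S) = c ^+ size s * S.
  case: s {IH P Q A PcA Q0 cross eP} @S => [|j s] S; last first.
    by rewrite /= exprS mulrA.
  by rewrite /S big_nil !mulr0.
have : c * (c ^+ size s + c ^+ (size s).-1 * S - ((size s)%:R - 1) / 2 * Q)
    <= c * P by rewrite ler_wpM2l.
have : c * (((size s)%:R - 1) / 2 * Q) <= ((size s)%:R - 1) / 2 * Q.
  case: s {IH PcA cross eP P S A ccS} @Q Q0 => [|j s] Q Q0.
    by rewrite /Q big_nil !mulr0.
  by rewrite ler_piMl// mulr_ge0// divr_ge0// subr_ge0 ler1n.
rewrite -[(size s).+1%:R]natr1 (exprS c (size s)); move: cross eP ccS.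
set K := (size s)%:R; set ck := c ^+ size s; set cp := c ^+ _.
lra.
Qed.

(** * The binary Pinsker inequality *)

(** Moving from [x] towards [c], on either side, [f] never decreases, since its derivative has the
    sign of y - x. The conditions are imposed only between the two points, so that [x] may be an
    endpoint of [0,1]. *)
Lemma min_of_derive_sign (R : realType) (f df : R -> R) (x c : R) :
  (forall y, Num.min x c <= y <= Num.max x c -> is_derive y 1 f (df y)) ->
  (forall y, Num.min x c <= y <= Num.max x c -> 0 <= df y * (y - x)) ->
  f x <= f c.
Proof.
move=> fdf df0.
have [->//|xc] := eqVneq x c.
(* Mean value theorem on the interval with its ends in increasing order, shared by the cases x < c
   and c < x. *)
have main a b : a < b -> Num.min x c = a -> Num.max x c = b ->
    exists2 y, y \in `]a, b[ & f b - f a = df y * (b - a).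
  move=> ab ea eb; apply: MVT => //.
    move=> y; rewrite in_itv/= => /andP[ay yb].
    by apply: fdf; rewrite ea eb !ltW.
  apply: derivable_within_continuous => y; rewrite in_itv/= => /andP[ay yb].
  have [] := fdf y; first by rewrite ea eb ay yb.
  by [].
case: (ltP x c) => [lt|]; last rewrite le_eqVlt eq_sym (negbTE xc)/= => lt.
  case: (main x c lt); rewrite ?min_l ?max_r ?(ltW lt)//.
  move=> y; rewrite in_itv/= => /andP[xy yc] e.
  have : 0 <= df y * (y - x) by apply: df0; rewrite min_l ?max_r ?ltW.
  rewrite pmulr_lge0 ?subr_gt0// => dy.
  by rewrite -subr_ge0 e mulr_ge0// subr_ge0 ltW.
case: (main c x lt); rewrite ?min_r ?max_l ?(ltW lt)//.
move=> y; rewrite in_itv/= => /andP[xy yc] e.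
have : 0 <= df y * (y - x) by apply: df0; rewrite min_r ?max_l ?ltW.
rewrite nmulr_lge0 ?subr_lt0// => dy.
by rewrite -subr_le0 e mulr_le0_ge0// subr_ge0 ltW.
Qed.

(** The first two terms form the tangent line of [entropy] at [c], so [entropy x] minus them is the
    relative entropy of Bernoulli(x) with respect to Bernoulli(c). *)
Lemma pinsker (R : realType) (x c : R) : 0 <= x <= 1 -> 0 < c < 1 ->
  entropy c + (ln c - ln (1 - c)) * (x - c) + 2 * (x - c) ^+ 2 <= entropy x.
Proof.
move=> /andP[x0 x1] /andP[c0 c1].
(* The difference of the two sides is studied as a function of c, not of x, so
   that the endpoints x = 0 and x = 1 are covered: there x ln c, respectively
   (1 - x) ln (1 - c), vanishes identically. *)
suff H : entropy x + 0 <= entropy x +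
    (entropy x - x * ln c - (1 - x) * ln (1 - c) - 2 * (x - c) ^+ 2).
  move: H; rewrite /entropy; nra.
rewrite lerD2l.
have subE (a y : R) : is_derive y 1 (fun y : R => a - y) (-1).
  rewrite (_ : (fun y => a - y) = cst a - id); last exact/funext.
  by apply: is_derive_eq; rewrite sub0r.
have sqE (y : R) : is_derive y 1 (fun y : R => 2 * (x - y) ^+ 2) (4 * (y - x)).
  have sE := subE x y.
  rewrite (_ : (fun _ => _) = 2 \*: ((fun y => x - y) * (fun y => x - y))).
    apply: is_derive_eq.
    rewrite /GRing.scale /=; ring.
  exact/funext.
have lnE (y : R) : x = 0 \/ 0 < y ->
    is_derive y 1 (fun y : R => x * ln y) (x / y).
  case=> [->|y0].
    rewrite (_ : (fun _ => _) = cst 0); last first.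
      by apply/funext => z; rewrite mul0r.
    by apply: is_derive_eq; rewrite mul0r.
  have ly := is_derive1_ln y0.
  rewrite (_ : (fun _ => _) = x *: @ln R); last exact/funext.
  exact: is_derive_eq.
have ln1E (y : R) : x = 1 \/ y < 1 ->
    is_derive y 1 (fun y : R => (1 - x) * ln (1 - y)) (- ((1 - x) / (1 - y))).
  case=> [->|y1].
    rewrite (_ : (fun _ => _) = cst 0); last first.
      by apply/funext => z; rewrite subrr mul0r.
    by apply: is_derive_eq; rewrite subrr mul0r oppr0.
  have h1 : is_derive (1 - y) 1 (@ln R) (1 - y)^-1.
    by apply: is_derive1_ln; rewrite subr_gt0.
  have sE := subE 1 y.
  rewrite (_ : (fun _ => _) = (1 - x) *: (@ln R \o (fun y => 1 - y))).
    by apply: is_derive_eq; rewrite mulrN1 scalerN.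
  exact/funext.
(* Since f x = - [entropy x], the difference to be bounded is f c - f x. *)
pose f y := - (x * ln y) - (1 - x) * ln (1 - y) - 2 * (x - y) ^+ 2.
(* Between [x] and [c], a point can fail to lie in ]0,1[ only if it equals [x]; there the sign
   condition is trivial. *)
have xyE y : Num.min x c <= y <= Num.max x c ->
    [/\ x = 0 \/ 0 < y, x = 1 \/ y < 1 & (y == x) || (0 < y < 1)].
  rewrite ge_min le_max => xy.
  split.
  - have [->|xn0] := eqVneq x 0; [by left|right].
    have {}x0 : 0 < x by rewrite lt_neqAle eq_sym xn0.
    by case/andP: xy => /orP[] h _; apply: lt_le_trans h.
  - have [->|xn1] := eqVneq x 1; [by left|right].
    have {}x1 : x < 1 by rewrite lt_neqAle xn1.
    by case/andP: xy => _ /orP[] h; apply: le_lt_trans h _.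
  - by case/andP: xy; case: (ltgtP y x) => //= yx; rewrite ?orbF => *; lra.
have := @min_of_derive_sign R f
  (fun y => - (x / y) + (1 - x) / (1 - y) - 4 * (y - x)) x c.
rewrite /f /entropy => H.
rewrite -subr_ge0 in H.
apply: le_trans (H _ _) _; last lra.
  move=> y /xyE[/lnE h1 /ln1E h2 _].
  have h3 := sqE y.
  rewrite (_ : (fun y => _) = - (fun y => x * ln y)
    - (fun y => (1 - x) * ln (1 - y))
    - (fun y => 2 * (x - y) ^+ 2)); last exact/funext.
  by have := is_deriveB (is_deriveB (is_deriveN h1) h2) h3; rewrite opprK.
move=> y /xyE[_ _ /orP[/eqP ->|/andP[y0 y1]]]; first by rewrite subrr mulr0.
(* The derivative of [f] is (y - x)(1/(y(1 - y)) - 4), and 1 - 4y(1 - y) = (1 - 2y)^2. This is where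
   the constant 2 in front of the square comes from. *)
rewrite (_ : _ * _ = (y - x) ^+ 2 * (1 - 2 * y) ^+ 2 / (y * (1 - y))).
  apply: divr_ge0; first by rewrite mulr_ge0// sqr_ge0.
  by rewrite mulr_ge0 ?subr_ge0 ?ltW.
by field; apply/andP; split; lra.
Qed.

(** * Integrals of bounded functions *)

Section bounded_integrals.
Local Open Scope ereal_scope.
Context d (T : measurableType d) (R : realType).

Lemma integral_mrestr (mu : {measure set T -> \bar R}) (D : set T)
    (mD : measurable D) (f : T -> \bar R) :
  \int[mrestr mu mD]_(x in D) f x = \int[mu]_(x in D) f x.
Proof.
by apply: eq_measure_integral => A mA AD; rewrite /= /mrestr setIidl.
Qed.

Lemma bounded_integrable (mu : {measure set T -> \bar R}) (D : set T)
    (f : T -> R) (M : R) : measurable D -> (mu D < +oo) ->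
  measurable_fun D f -> (forall x, D x -> (`|f x| <= M)%R) ->
  mu.-integrable D (EFin \o f).
Proof.
move=> mD Doo mf fM; apply: measurable_bounded_integrable => //.
exists M; split; first exact: num_real.
by move=> x Mx t Dt; exact: le_trans (fM _ Dt) (ltW Mx).
Qed.

Lemma Rintegral_cst_unit (mu : {measure set T -> \bar R}) (D : set T) (r : R) :
  measurable D -> mu D = 1 -> (\int[mu]_(x in D) r = r)%R.
Proof. by move=> mD muD; rewrite Rintegral_cst// muD mulr1. Qed.

Lemma integrable_sum_EFin (mu : {measure set T -> \bar R}) (D : set T)
    (I : Type) (s : seq I) (F : I -> T -> R) : measurable D ->
  (forall i, mu.-integrable D (EFin \o F i)) ->
  mu.-integrable D (EFin \o fun x => (\sum_(i <- s) F i x)%R).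
Proof.
move=> mD iF; rewrite (_ : _ \o _ = fun x => \sum_(i <- s) (F i x)%:E).
  by apply: integrable_sum => // i _; exact: iF.
by apply/funext => x /=; rewrite sumEFin.
Qed.

Lemma Rintegral_sum (mu : {measure set T -> \bar R}) (D : set T) (I : Type)
    (s : seq I) (F : I -> T -> R) : measurable D ->
  (forall i, mu.-integrable D (EFin \o F i)) ->
  (\int[mu]_(x in D) (\sum_(i <- s) F i x) =
   \sum_(i <- s) \int[mu]_(x in D) F i x)%R.
Proof.
move=> mD iF; elim: s => [|i s IH].
  rewrite big_nil -[RHS](mul0r (fine (mu D))) -Rintegral_cst//.
  by apply: eq_Rintegral => x _; rewrite big_nil.
rewrite big_cons -IH -RintegralD//; last exact: integrable_sum_EFin.
by apply: eq_Rintegral => x _; rewrite big_cons.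
Qed.

Lemma ae_eq0_of_Rintegral_eq0 (mu : {measure set T -> \bar R}) (D : set T)
    (f : T -> R) : measurable D -> mu.-integrable D (EFin \o f) ->
  (forall x, D x -> (0 <= f x)%R) -> (\int[mu]_(x in D) f x = 0)%R ->
  {ae mu, forall x, D x -> f x = 0%R}.
Proof.
move=> mD intf f0 If.
have int0 : \int[mu]_(x in D) `|(EFin \o f) x| = 0.
  rewrite (eq_integral (EFin \o f)); last first.
    by move=> x; rewrite inE => /f0 fx0; rewrite /= ger0_norm.
  (* [Rintegral] is [fine] of the extended integral, and [fine] also sends infinities to 0;
     integrability excludes that case. *)
  by rewrite -[LHS]fineK ?integrable_fin_num//; congr EFin.
have /integrableP[mf _] := intf.
have /(ae_eq_integral_abs mu mD mf) := int0.
by apply: filterS => x h /h [].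
Qed.

End bounded_integrals.

(** * Two-coordinate marginals of the product measure on a cube *)

Section cube_marginal.
Context d (T : measurableType d) (R : realType).
Variables (mu : {sigma_finite_measure set T -> \bar R}) (U : set T).
Hypotheses (mU : measurable U) (muU : mu U = 1%E).

(** Only the restriction of [mu] to [U] is known to be a probability, so marginals are taken within
    this cube; for the unit interval it is [unit_cube]. *)
Definition box n : set (n.-tuple T) := [set t | forall i, U (tnth t i)].

Lemma measurable_box n (A : 'I_n -> set T) : (forall i, measurable (A i)) ->
  measurable [set t : n.-tuple T | forall i, A i (tnth t i)].
Proof.
move=> mA; rewrite (_ : [set _ | _] = \bigcap_(i in [set: 'I_n])
    ((fun t : n.-tuple T => tnth t i) @^-1` A i)).
  apply: fin_bigcap_measurable => // i _; rewrite -[X in measurable X]setTI.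
  exact: measurable_tnth.
by apply/seteqP; split=> t h i => [_|]; [exact: h|exact: (h i I)].
Qed.

Lemma tuple_measure_cube n : tuple_measure mu n (@box n) = 1%E.
Proof. by rewrite (tuple_measure_box mu (fun=> mU)) big1. Qed.

Lemma measurable_tnth_pair n (i j : 'I_n) :
  measurable_fun [set: n.-tuple T] (fun t : n.-tuple T => (tnth t i, tnth t j)).
Proof. by apply/measurable_fun_pair; exact: measurable_tnth. Qed.

(** Both sides are finite measures in [A]. They agree on measurable rectangles, which are stable
    under intersection and generate the product sigma-algebra, so they agree everywhere. *)
Lemma cube_marginal_measure n (i j : 'I_n) (A : set (T * T)) : i != j ->
  measurable A ->
  tuple_measure mu n ((fun t => (tnth t i, tnth t j)) @^-1` A `&` @box n) =
  (mu \x mu)%E (A `&` (U `*` U)).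
Proof.
move=> ij mA.
have mbox : measurable (@box n) by exact: (measurable_box (fun=> mU)).
have mUU : measurable (U `*` U) by exact: measurableX.
pose phi (t : n.-tuple T) := (tnth t i, tnth t j).
have mphi := @measurable_tnth_pair n i j; rewrite -/phi in mphi.
pose m1 := @measure_function_pushforward__canonical__measure_function_Measure
  _ _ _ _ _ (mrestr (tuple_measure mu n) mbox) _ mphi.
pose m2 := mrestr (mu \x mu)%E mUU.
suff : m1 A = m2 A by [].
pose G : set (set (T * T)) := [set A `*` B | A in measurable & B in measurable].
apply: (measure_unique G (fun=> setT)) => //.
- exact: measurable_prod_measurableType.
- move=> _ _ [X1 mX1 [X2 mX2 <-]] [Y1 mY1 [Y2 mY2 <-]].
  rewrite -setXI; exists (X1 `&` Y1); first exact: measurableI.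
  by exists (X2 `&` Y2) => //; exact: measurableI.
- by move=> _; exists setT => //; exists setT => //; rewrite setXTT.
- by rewrite bigcup_const.
- move=> _ [X mX [Y mY <-]].
  rewrite /m1 /m2 /= /pushforward /mrestr -setXI.
  rewrite product_measure1E; [|exact: measurableI..].
  (* The preimage of a rectangle within the cube is again a box, with sides [B k]; the sides other
     than [i] and [j] have measure 1. *)
  pose B k := if k == i then X `&` U else if k == j then Y `&` U else U.
  have mB k : measurable (B k).
    by rewrite /B; case: ifP => _; [|case: ifP => _] => //; exact: measurableI.
  have ji : (j == i) = false by rewrite eq_sym (negbTE ij).
  rewrite (_ : _ `&` _ = [set t : n.-tuple T | forall k, B k (tnth t k)]).
    rewrite tuple_measure_box// (bigD1 i)//= (bigD1 j) ?ji//= big1 ?mule1.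
      by rewrite /B eqxx ji eqxx.
    by move=> k /andP[ki kj]; rewrite /B (negbTE ki) (negbTE kj).
  apply/seteqP; split=> [t [[tX tY] tU] k|t tB].
    rewrite /B; case: ifP => [/eqP ->|_]; first by split => //; exact: tU.
    by case: ifP => [/eqP ->|_]; [split => //|]; exact: tU.
  split; first split.
  + by have := tB i; rewrite /B eqxx => -[].
  + by have := tB j; rewrite /B ji eqxx => -[].
  + move=> k; have := tB k; rewrite /B; case: ifP => _; first by case.
    by case: ifP => _ //; case.
- move=> _; rewrite /= /pushforward /= /mrestr preimage_setT setTI.
  by rewrite tuple_measure_cube ltry.
Qed.

(** Change of variables along t -> (t_i, t_j), applied to [f] extended by zero because [f] is
    controlled only on the square. *)
Lemma cube_marginal n (i j : 'I_n) (f : T * T -> R) (M : R) : i != j ->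
  measurable_fun (U `*` U) f -> (forall z, (U `*` U) z -> `|f z| <= M) ->
  \int[tuple_measure mu n]_(t in @box n) f (tnth t i, tnth t j) =
  \int[(mu \x mu)%E]_(z in U `*` U) f z.
Proof.
move=> ij mf fM.
have mbox : measurable (@box n) by exact: (measurable_box (fun=> mU)).
have mUU : measurable (U `*` U) by exact: measurableX.
pose phi (t : n.-tuple T) := (tnth t i, tnth t j).
have mphi := @measurable_tnth_pair n i j; rewrite -/phi in mphi.
pose g := f \_ (U `*` U).
have mg : measurable_fun setT g by apply/(measurable_restrictT _ mUU).
have gM z : `|g z| <= `|M|.
  rewrite /g patchE; case: ifPn => [|_]; last by rewrite normr0.
  by rewrite inE => /fM /le_trans; apply; exact: ler_norm.
rewrite /Rintegral; congr fine.
transitivity (\int[tuple_measure mu n]_(t in @box n) (EFin \o g \o phi) t)%E.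
  apply: eq_integral => t; rewrite inE => tU /=.
  by rewrite /g patchE mem_set//; split; exact: tU.
transitivity (\int[(mu \x mu)%E]_(z in U `*` U) (EFin \o g) z)%E; last first.
  by apply: eq_integral => t tU /=; rewrite /g patchE tU.
pose m1 := mrestr (tuple_measure mu n) mbox.
rewrite -(integral_mrestr _ mbox).
have phiU : @box n `<=` phi @^-1` (U `*` U) by move=> t tU; split; exact: tU.
have mphiU : measurable (phi @^-1` (U `*` U)).
  by rewrite -[X in measurable X]setTI; exact: mphi.
(* The pushforward formula integrates over a full preimage, which constrains only two coordinates.
   It exceeds the cube by a set that is null for the restricted measure [m1]. *)
have boxE : phi @^-1` (U `*` U) `\` (phi @^-1` (U `*` U) `\` @box n) = @box n.
  by rewrite setDD; apply/setIidPr.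
have fin : (m1 (phi @^-1` (U `*` U)) < +oo)%E.
  apply: (@le_lt_trans _ _ (tuple_measure mu n (@box n))).
    by rewrite /m1 /= /mrestr le_measure ?inE//; exact: measurableI.
  by rewrite tuple_measure_cube ltry.
have ig : m1.-integrable (phi @^-1` (U `*` U)) (EFin \o g \o phi).
  apply: measurable_bounded_integrable => //.
    apply: measurableT_comp => //; exact: measurable_funTS.
  exists `|M|; split; first exact: num_real.
  by move=> x xM t _ /=; exact: le_trans (gM _) (ltW xM).
rewrite -/m1 -[X in integral _ X]boxE -negligible_integral//; last 2 first.
- exact: measurableD.
- by rewrite /= /mrestr setDE -setIA setICl setI0 measure0.
rewrite -integral_pushforward//; last exact/measurable_EFinP.
apply: eq_measure_integral => A mA AU.
transitivity ((mu \x mu)%E (A `&` (U `*` U))); last by rewrite setIidl.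
exact: cube_marginal_measure.
Qed.

End cube_marginal.

(** * Lower bounds for the homomorphism density and the entropy integral *)

Section graphons.
Context {R : realType}.
Local Notation T := (measurableTypeR R).
Local Notation leb := (@lebesgue_measure R).
Local Notation leb2 := (leb \x leb)%E.
Local Notation D := (@unit_square R).

Lemma measurable_entropy : measurable_fun setT (@entropy R).
Proof.
apply: measurable_funD; apply: measurable_funM => //.
- exact: measurable_funB.
- apply: measurableT_comp; first exact: measurable_ln.
  exact: measurable_funB.
Qed.

(** The lower bound is [pinsker] at c = 1/2, where the linear term vanishes and [entropy] equals
    ln(1/2); the upper bound holds because both summands are nonpositive. *)
Lemma entropy_bounded (x : R) : 0 <= x <= 1 -> `|entropy x| <= - ln 2^-1.
Proof.
move=> x01; have h : 0 < (2^-1 : R) < 1 by apply/andP; split; lra.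
have := pinsker x01 h.
have xlnx (y : R) : 0 <= y <= 1 -> y * ln y <= 0.
  by case/andP=> y0 y1; rewrite mulr_ge0_le0// ln_le0.
have := xlnx x x01.
have : (1 - x) * ln (1 - x) <= 0.
  by apply: xlnx; case/andP: x01 => *; apply/andP; split; lra.
rewrite ler_norml /entropy (_ : 1 - 2^-1 = 2^-1); last by field.
have := sqr_ge0 (x - 2^-1).
have : ln (2^-1 : R) <= 0 by apply: ln_le0; lra.
set l := ln 2^-1; set s := (x - _) ^+ 2.
move=> l0 s0 h1 h2 h3; apply/andP; split; lra.
Qed.

Lemma measurable_unit_interval : measurable (`[0, 1]%classic : set T).
Proof. exact: measurable_itv. Qed.

Lemma measure_unit_interval : leb `[0, 1]%classic = 1%E.
Proof. by rewrite lebesgue_measure_itv/= lte_fin ltr01 oppr0 adde0. Qed.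

Lemma measurable_unit_square : measurable D.
Proof. by apply: measurableX; exact: measurable_unit_interval. Qed.

Lemma measure_unit_square : leb2 D = 1%E.
Proof.
have mI := measurable_unit_interval.
rewrite -(mule1 1%E) -[in RHS]measure_unit_interval.
exact: (product_measure1E leb leb mI mI).
Qed.

Lemma measurable_unit_cube n : measurable (@unit_cube R n).
Proof. exact: (measurable_box (fun=> measurable_unit_interval)). Qed.

Lemma measure_unit_cube n : tuple_measure leb n (@unit_cube R n) = 1%E.
Proof.
exact: (tuple_measure_cube measurable_unit_interval measure_unit_interval).
Qed.

Lemma unit_cube_fin n : (tuple_measure leb n (@unit_cube R n) < +oo)%E.
Proof. by rewrite measure_unit_cube ltry. Qed.

Section graphon_integrals.
Variables (h : T * T -> R) (eps : R).
Hypotheses (hg : graphon h) (heps : edge_density h = eps).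

Let mh : measurable_fun D h. Proof. by case: hg. Qed.
Let h01 z : D z -> 0 <= h z <= 1. Proof. by case: hg => _ h01 _ /h01. Qed.
Let mD := measurable_unit_square.
Let Dfin : (leb2 D < +oo)%E.
Proof. by rewrite measure_unit_square ltry. Qed.

Lemma integrable_graphon_comp (g : R -> R) (M : R) : measurable_fun setT g ->
  (forall x, 0 <= x <= 1 -> `|g x| <= M) ->
  leb2.-integrable D (EFin \o (g \o h)).
Proof.
move=> mg gM; apply: (@bounded_integrable _ _ _ _ _ _ M) => //.
  exact: measurableT_comp.
by move=> z /h01 /gM.
Qed.

(** An edge involves only two distinct coordinates, so every edge contributes the same integral over
    the square. *)
Lemma Rintegral_cube_comp n (i j : 'I_n) (g : R -> R) (M : R) : i != j ->
  measurable_fun setT g -> (forall x, 0 <= x <= 1 -> `|g x| <= M) ->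
  \int[tuple_measure leb n]_(t in @unit_cube R n) g (h (tnth t i, tnth t j)) =
  \int[leb2]_(z in D) g (h z).
Proof.
move=> ij mg gM.
apply: (@cube_marginal _ _ _ leb _ measurable_unit_interval
  measure_unit_interval n i j (g \o h) M) => //.
  exact: measurableT_comp.
by move=> z /h01 /gM.
Qed.

Lemma integrable_cube_comp n (i j : 'I_n) (g : R -> R) (M : R) :
  measurable_fun setT g -> (forall x, 0 <= x <= 1 -> `|g x| <= M) ->
  (tuple_measure leb n).-integrable (@unit_cube R n)
    (EFin \o (fun t => g (h (tnth t i, tnth t j)))).
Proof.
move=> mg gM.
have mC := @measurable_unit_cube n.
have CD t : @unit_cube R n t -> D (tnth t i, tnth t j).
  by move=> Ct; split; exact: Ct.
apply: (@bounded_integrable _ _ _ _ _ _ M) => //.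
- exact: unit_cube_fin.
- apply: (measurableT_comp mg).
  apply: (measurable_comp mD _ mh) => [_ [t Ct <-]|]; first exact: CD.
  by apply: measurable_funTS; exact: measurable_tnth_pair.
- by move=> t /CD /h01 /gM.
Qed.

Let m1 : leb2 D = 1%E := measure_unit_square.

(** This is V of the overview: the variance of [h] on the square, since its mean is [eps]. *)
Let sqdev := \int[leb2]_(z in D) (h z - eps) ^+ 2.

Hypothesis eps01 : 0 <= eps <= 1.

Let dev_bounded (x : R) : 0 <= x <= 1 -> `|x - eps| <= 1.
Proof.
move: eps01 => /andP[? ?] /andP[? ?].
by rewrite ler_norml; apply/andP; split; lra.
Qed.

Let sqdev_bounded (x : R) : 0 <= x <= 1 -> `|(x - eps) ^+ 2| <= 1.
Proof. by move=> /dev_bounded; rewrite normrX; exact: exprn_ile1. Qed.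

Let mdev : measurable_fun setT (fun x : R => x - eps).
Proof. exact: measurable_funB. Qed.

Let msqdev : measurable_fun setT (fun x : R => (x - eps) ^+ 2).
Proof. exact: measurable_funX. Qed.

Lemma Rintegral_dev : \int[leb2]_(z in D) (h z - eps) = 0.
Proof.
rewrite RintegralB//.
- by rewrite (Rintegral_cst_unit _ mD m1) -heps subrr.
- apply: (integrable_graphon_comp (g := id) (M := 1)) => // x /andP[x0 x1].
  by rewrite ger0_norm.
- apply: (@bounded_integrable _ _ _ _ _ (cst eps) 1) => // x _.
  by case/andP: eps01 => ? ?; rewrite ger0_norm.
Qed.

(** [prod_ge_tangent] is integrated over the cube with c = [eps]: the linear terms vanish and each
    of the m edges loses (m - 1)/2 V. *)
Lemma hom_density_lower n (e : rel 'I_n) :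
  eps ^+ #|edges e| - #|edges e|%:R * (#|edges e|%:R - 1) / 2 * sqdev
  <= hom_density e h.
Proof.
set m := #|edges e|.
(* The contribution of a single edge to the tangent bound. *)
pose g x := eps ^+ m.-1 * (x - eps) - (m%:R - 1) / 2 * (x - eps) ^+ 2.
have mg : measurable_fun setT g.
  by apply: measurable_funB; exact: measurable_funM.
have gM x : 0 <= x <= 1 -> `|g x| <= `|eps ^+ m.-1| + `|(m%:R - 1) / 2|.
  move=> x01; rewrite (le_trans (ler_normB _ _))// lerD// normrM ler_piMr//.
    exact: dev_bounded.
  exact: sqdev_bounded.
have Ig : \int[leb2]_(z in D) g (h z) = - ((m%:R - 1) / 2 * sqdev).
  rewrite /g RintegralB//.
  - rewrite RintegralZl//; last first.
      exact: (integrable_graphon_comp mdev dev_bounded).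
    rewrite Rintegral_dev mulr0 sub0r RintegralZl//.
    exact: (integrable_graphon_comp msqdev sqdev_bounded).
  - apply: (integrable_graphon_comp (g := fun x => eps ^+ m.-1 * (x - eps))
      (M := `|eps ^+ m.-1|)).
      exact: measurable_funM.
    by move=> x x01; rewrite normrM ler_piMr// dev_bounded.
  - apply: (integrable_graphon_comp
      (g := fun x => (m%:R - 1) / 2 * (x - eps) ^+ 2) (M := `|(m%:R - 1) / 2|)).
      exact: measurable_funM.
    by move=> x x01; rewrite normrM ler_piMr// sqdev_bounded.
have mC := @measurable_unit_cube n.
have Cfin := unit_cube_fin n.
(* Edges are stored with i < j, so their endpoints are distinct, as the marginal formula
   requires. *)
have ne p : p \in enum (edges e) -> p.1 != p.2.
  by rewrite mem_enum inE => /andP[+ _]; rewrite ltn_neqAle => /andP[].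
have ig p := integrable_cube_comp p.1 p.2 mg gM.
pose S (t : n.-tuple T) :=
  \sum_(p <- enum (edges e)) g (h (tnth t p.1, tnth t p.2)).
have iS : (tuple_measure leb n).-integrable (@unit_cube R n)
    (EFin \o S).
  exact: integrable_sum_EFin.
have iC : (tuple_measure leb n).-integrable (@unit_cube R n)
    (EFin \o cst (eps ^+ m)).
  exact: (@bounded_integrable _ _ _ _ _ _ `|eps ^+ m|).
have -> : eps ^+ m - m%:R * (m%:R - 1) / 2 * sqdev =
    \int[tuple_measure leb n]_(t in @unit_cube R n) (eps ^+ m + S t).
  rewrite RintegralD//.
  rewrite (Rintegral_cst_unit _ mC (measure_unit_cube n)).
  rewrite Rintegral_sum//; last by move=> p; exact: ig.
  rewrite (eq_big_seq (fun=> - ((m%:R - 1) / 2 * sqdev))); last first.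
    by move=> p /ne ijp; rewrite (Rintegral_cube_comp ijp mg gM).
  rewrite big_const_seq count_predT iter_addr_0 -cardE -mulr_natl.
  by congr (_ + _); ring.
have a01 t (p : 'I_n * 'I_n) : unit_cube t ->
    0 <= h (tnth t p.1, tnth t p.2) <= 1.
  by move=> Ct; apply: h01; split; exact: Ct.
rewrite /hom_density; apply: le_Rintegral => //.
- rewrite (_ : _ \o _ = (EFin \o cst (eps ^+ m)) \+ (EFin \o S)).
    exact: integrableD.
  exact/funext.
- apply: (@bounded_integrable _ _ _ _ _ _ 1) => //.
    rewrite (_ : (fun _ => _) = fun t =>
      \prod_(p <- enum (edges e)) h (tnth t p.1, tnth t p.2)); last first.
      by apply/funext => t; rewrite big_enum.
    apply: measurable_prod => p _.
    have /integrableP[+ _] : (tuple_measure leb n).-integrable (@unit_cube R n)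
        (EFin \o (fun t => h (tnth t p.1, tnth t p.2))).
      apply: (@integrable_cube_comp n p.1 p.2 id 1) => // x /andP[x0 x1].
      by rewrite ger0_norm.
    by move/measurable_EFinP.
  move=> t Ct; rewrite ger0_norm.
    by apply: prodr_ile1 => p _; exact: a01.
  by apply: prodr_ge0 => p _; have /andP[] := a01 t p Ct.
move=> t /a01 {}a01.
have := prod_ge_tangent (enum (edges e)) eps01 a01.
rewrite [X in _ <= X]big_enum -cardE -/m; apply: le_trans.
by rewrite /S big_split/= sumrN -!mulr_sumr addrA.
Qed.

(** [pinsker] is integrated with c = [eps]; its linear term has integral zero. *)
Lemma integral_entropy_lower : 0 < eps < 1 ->
  entropy eps + 2 * sqdev <= \int[leb2]_(z in D) entropy (h z).
Proof.
move=> eps01'.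
set l := ln eps - ln (1 - eps).
have i0 : leb2.-integrable D (EFin \o cst (entropy eps)).
  exact: (@bounded_integrable _ _ _ _ _ _ `|entropy eps|).
have i1 : leb2.-integrable D (EFin \o fun z => l * (h z - eps)).
  apply: (integrable_graphon_comp (g := fun x => l * (x - eps)) (M := `|l|)).
    exact: measurable_funM.
  by move=> x x01; rewrite normrM ler_piMr// dev_bounded.
have i2 : leb2.-integrable D (EFin \o fun z => 2 * (h z - eps) ^+ 2).
  apply: (integrable_graphon_comp (g := fun x => 2 * (x - eps) ^+ 2) (M := 2)).
    exact: measurable_funM.
  by move=> x x01; rewrite normrM ger0_norm// ler_piMr// sqdev_bounded.
have i01 : leb2.-integrable D (EFin \o fun z => entropy eps + l * (h z - eps)).
  rewrite (_ : _ \o _ = (EFin \o cst (entropy eps)) \+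
    (EFin \o fun z => l * (h z - eps))); first exact: integrableD.
  exact/funext.
have -> : entropy eps + 2 * sqdev = \int[leb2]_(z in D)
    (entropy eps + l * (h z - eps) + 2 * (h z - eps) ^+ 2).
  rewrite RintegralD// RintegralD// (Rintegral_cst_unit _ mD m1).
  rewrite RintegralZl//; last exact: (integrable_graphon_comp mdev dev_bounded).
  rewrite Rintegral_dev mulr0 addr0 RintegralZl//.
  exact: (integrable_graphon_comp msqdev sqdev_bounded).
apply: le_Rintegral => //.
- rewrite (_ : _ \o _ = (EFin \o fun z => entropy eps + l * (h z - eps)) \+
    (EFin \o fun z => 2 * (h z - eps) ^+ 2)); first exact: integrableD.
  exact/funext.
- exact: (integrable_graphon_comp measurable_entropy entropy_bounded).
- by move=> z /h01 h01z; exact: pinsker.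
Qed.

Lemma ae_eq_of_sqdev_eq0 : sqdev = 0 ->
  {ae leb2, forall z, D z -> h z = eps}.
Proof.
move=> s0; have := @ae_eq0_of_Rintegral_eq0 _ _ _ leb2 D _ mD
  (integrable_graphon_comp msqdev sqdev_bounded) (fun z _ => sqr_ge0 _) s0.
by apply: filterS => z hz /hz /eqP; rewrite sqrf_eq0 subr_eq0 => /eqP.
Qed.

Lemma ae_eq_of_extreme_density : eps = 0 \/ eps = 1 ->
  {ae leb2, forall z, D z -> h z = eps}.
Proof.
move=> e01.
(* At an extreme density h - [eps] has constant sign, recorded by [s], and mean zero, so it vanishes
   almost everywhere. *)
have [s s0 sdev] : exists2 s : R, s != 0 &
    forall x, 0 <= x <= 1 -> 0 <= s * (x - eps).
  by case: e01 => ->; [exists 1|exists (-1)]; rewrite ?oppr_eq0 ?oner_neq0//;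
    move=> x /andP[? ?]; lra.
have sM x : 0 <= x <= 1 -> `|s * (x - eps)| <= `|s|.
  by move=> x01; rewrite normrM ler_piMr// dev_bounded.
have si : leb2.-integrable D (EFin \o fun z => s * (h z - eps)).
  apply: (integrable_graphon_comp (g := fun x => s * (x - eps)) _ sM).
  exact: measurable_funM.
have : \int[leb2]_(z in D) (s * (h z - eps)) = 0.
  rewrite RintegralZl ?Rintegral_dev ?mulr0//.
  exact: (integrable_graphon_comp mdev dev_bounded).
move/(ae_eq0_of_Rintegral_eq0 mD si) => /(_ (fun z Dz => sdev _ (h01 Dz))).
apply: filterS => z hz /hz /eqP.
by rewrite mulf_eq0 (negbTE s0)/= subr_eq0 => /eqP.
Qed.

End graphon_integrals.

(** * Comparison of an optimizer with the constant graphon *)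

Lemma graphon_cst (c : R) : 0 <= c <= 1 -> graphon (cst c).
Proof. by move=> c01; split. Qed.

Lemma edge_density_cst (c : R) : edge_density (cst c) = c.
Proof.
exact: (Rintegral_cst_unit _ measurable_unit_square measure_unit_square).
Qed.

Lemma functional_cst n (e : rel 'I_n) (beta c : R) :
  functional e beta (cst c) = beta * c ^+ #|edges e| - 2^-1 * entropy c.
Proof.
rewrite /functional /hom_density; congr (_ * _ - _ * _).
  under eq_Rintegral do rewrite prodr_const.
  exact: (Rintegral_cst_unit _ (@measurable_unit_cube n) (measure_unit_cube n)).
exact: (Rintegral_cst_unit (entropy c) measurable_unit_square
  measure_unit_square).
Qed.

End graphons.

Theorem proposition10 (R : realType) (n : nat) (e : rel 'I_n)
    (e_sym : symmetric e) (e_irr : irreflexive e) (beta2 : R)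
    (beta2_lt0 : beta2 < 0)
    (beta2_small :
      `|beta2| * #|edges e|%:R * (#|edges e|%:R - 1) < 2)
    (eps : R) (eps01 : 0 <= eps <= 1)
    (h : measurableTypeR R * measurableTypeR R -> R) :
  optimizing_graphon e eps beta2 h -> uniform h.
Proof.
case=> hg heps hmax; exists eps.
have [e0|en0] := eqVneq eps 0; first by apply: ae_eq_of_extreme_density; auto.
have [e1|en1] := eqVneq eps 1; first by apply: ae_eq_of_extreme_density; auto.
have eps01' : 0 < eps < 1.
  by case/andP: eps01 => ? ?; rewrite !lt_neqAle eq_sym en0 en1; apply/andP.
apply: ae_eq_of_sqdev_eq0 => //.
set V := Rintegral _ _ _.
have V0 : 0 <= V by apply: Rintegral_ge0 => z _; exact: sqr_ge0.
(* The constant graphon is an admissible competitor, so the optimizer does at least as well. *)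
have : functional e beta2 (cst eps) <= functional e beta2 h.
  rewrite -lee_fin hmax; apply: ereal_sup_ubound; exists (cst eps) => //.
  by split; [exact: graphon_cst|exact: edge_density_cst].
rewrite functional_cst /functional.
have := integral_entropy_lower hg heps eps01 eps01'.
have := hom_density_lower hg heps eps01 e.
move: beta2_small; rewrite ltr0_norm// -/V.
move: (hom_density _ _) (Rintegral _ _ _) (_ ^+ _) => t I c.
set m : R := #|edges e|%:R => small tlow Ilow opt.
(* Negativity of [beta2] turns the lower bound on the density into an upper bound on its term. *)
have : beta2 * t <= beta2 * (c - m * (m - 1) / 2 * V) by rewrite ler_nM2l.
move=> bt; apply/eqP; rewrite eq_le V0 andbT.
(* Adding the three estimates cancels the terms at the constant [eps]; the smallness of [beta2]
   makes the remaining coefficient of V positive, forcing V <= 0. *)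
have : (2 + beta2 * m * (m - 1)) * V <= 0 by lra.
by rewrite pmulr_rle0//; lra.
Qed.
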